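(* The following data defines a functor $\mathcal{E}\mathrm{nds}(-):\mathbf{PGeo}^{\mathrm{Crs}}\to\mathbf{Set}$: each $X\in\mathbf{PGeo}^{\mathrm{Crs}}$ is sent to its set of ends $\mathcal{E}\mathrm{nds}(X)$, and each morphism $f:X\to Y$ of $\mathbf{PGeo}^{\mathrm{Crs}}$ is sent to the function $f_{\mathcal{E}}:\mathcal{E}\mathrm{nds}(X)\to\mathcal{E}\mathrm{nds}(Y)$ defined by $f_{\mathcal{E}}:\mathrm{end}(r)\mapsto\mathrm{end}((f\circ r)^* )$. Further, $\mathcal{E}\mathrm{nds}(-)$ sends close maps to equal maps.
   Context: A metric space is proper if its subsets that are closed and bounded are exactly its compact subsets. A metric space $X$ is geodesic if any $x,x'\in X$ are joined by a geodesic, i.e. an isometric embedding $u_{x,x'}:[0,a_{x,x'}]\to X$ with $a_{x,x'}=d_X(x,x')$, $u_{x,x'}(0)=x$, $u_{x,x'}(a_{x,x'})=x'$. A map $f:X\to Y$ of metric spaces is controlled if for every $R>0$ there is $S>0$ such that $d_X(x,x')<R$ implies $d_Y(f(x),f(x'))<S$; (metrically) proper if preimages of bounded sets are bounded; coarse if controlled and proper. Maps $f,f':X\to Y$ are close if there is $C\ge0$ with $d_Y(f(x),f'(x))\le C$ for all $x\in X$. $\mathbf{PGeo}^{\mathrm{Crs}}$ is the category of proper geodesic metric spaces and coarse maps. A ray in $X$ is a map $\mathbb{R}_{\ge0}\to X$. For a proper metric space $X$, two metrically proper continuous rays $r,r'$ are equivalent if for every bounded $B\subseteq X$ there is $t\ge0$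 such that $r([t,\infty))$ and $r'([t,\infty))$ lie in the same path component of $X\setminus B$. $\mathcal{E}\mathrm{nds}(X)$ is the set of equivalence classes; the class of a metrically proper continuous ray $r$ is $\mathrm{end}(r)$. For a geodesic space $X$ and any map $r:\mathbb{R}_{\ge0}\to X$, $r^*:\mathbb{R}_{\ge0}\to X$ denotes the continuous map $r^*(h)=u_{r(\lfloor h\rfloor),r(\lceil h\rceil)}\big(a_{r(\lfloor h\rfloor),r(\lceil h\rceil)}(h-\lfloor h\rfloor)\big)$, where $u_{r(\lfloor h\rfloor),r(\lceil h\rceil)}$ is a choice of geodesic from $r(\lfloor h\rfloor)$ to $r(\lceil h\rceil)$ (so $r^*$ agrees with $r$ on $\mathbb{Z}_{\ge0}$). In the formula for $f_{\mathcal{E}}$, $r$ is any metrically proper continuous ray in $X$ representing the given end; that $f_{\mathcal{E}}$ is well defined is part of the claim.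
   Formalization: The formula end(r) ↦ end((f∘r)^* ) is required only for representatives r with (f∘r)^* metrically proper, since otherwise its end is undefined; every end is shown to have a controlled representative, and for these (f∘r)^* is metrically proper. *)

(* Defs.v *)
From mathcomp Require Import all_boot all_order all_algebra.
From mathcomp Require Import all_classical all_reals all_analysis.

Set Implicit Arguments.
Unset Strict Implicit.
Unset Printing Implicit Defensive.

Import Order.TTheory GRing.Theory Num.Theory.
Import numFieldNormedType.Exports.
Local Open Scope classical_set_scope.
Local Open Scope ring_scope.

Record category := Category {
  ob :> Type;
  hom : ob -> ob -> Type;
  idm : forall X, hom X X;
  comp : forall X Y Z, hom Y Z -> hom X Y -> hom X Z;
  comp1m : forall X Y (f : hom X Y), comp (idm Y) f = f;
  compm1 : forall X Y (f : hom X Y), comp f (idm X) = f;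
  compmA : forall X Y Z W (h : hom Z W) (g : hom Y Z) (f : hom X Y),
    comp h (comp g f) = comp (comp h g) f
}.
Arguments hom {c} _ _.
Arguments idm {c} X.
Arguments comp {c X Y Z} _ _.

Definition is_functor (C D : category) (F0 : C -> D)
    (F1 : forall X Y : C, hom X Y -> hom (F0 X) (F0 Y)) : Prop :=
  (forall X : C, F1 X X (idm X) = idm (F0 X)) /\
  (forall (X Y Z : C) (g : hom Y Z) (f : hom X Y),
     F1 X Z (comp g f) = comp (F1 Y Z g) (F1 X Y f)).

Definition Sets : category :=
  @Category Type (fun A B => A -> B) (fun A => @id A)
    (fun A B C g f => g \o f)
    (fun _ _ _ => erefl) (fun _ _ _ => erefl) (fun _ _ _ _ _ _ _ => erefl).

Section MetricNotions.
Context {R : realType}.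

Definition mbounded (X : metricType R) (A : set X) : Prop :=
  exists M : R, forall x y, A x -> A y -> mdist x y <= M.

Definition proper_space (X : metricType R) : Prop :=
  forall A : set X, closed A /\ mbounded A <-> compact A.

(* [u : R -> X] stands for a map on [0, d(x, y)]; its values elsewhere are
   irrelevant. *)
Definition geodesic_from_to (X : metricType R) (x y : X) (u : R -> X) : Prop :=
  [/\ {in `[0, mdist x y] &, forall s t, mdist (u s) (u t) = `|s - t|},
      u 0 = x & u (mdist x y) = y].

Definition geodesic_space (X : metricType R) : Prop :=
  forall x y : X, exists u : R -> X, geodesic_from_to x y u.

(* Maps defined on a subset [A] of a metric space are represented by functions
   on the whole space, of which only the values on [A] matter. *)
Definition controlled_on (X Y : metricType R) (A : set X) (f : X -> Y) : Prop :=
  forall r : R, 0 < r -> exists2 s : R, 0 < s &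
    forall x x', A x -> A x' -> mdist x x' < r -> mdist (f x) (f x') < s.

Definition metrically_proper_on (X Y : metricType R) (A : set X)
    (f : X -> Y) : Prop :=
  forall B : set Y, mbounded B -> mbounded (A `&` f @^-1` B).

Definition coarse (X Y : metricType R) (f : X -> Y) : Prop :=
  controlled_on setT f /\ metrically_proper_on setT f.

Definition close_maps (X Y : metricType R) (f f' : X -> Y) : Prop :=
  exists2 C : R, 0 <= C & forall x, mdist (f x) (f' x) <= C.

Lemma coarse_id (X : metricType R) : coarse (@id X).
Proof.
split=> [r r0|B [M bM]]; first by exists r.
by exists M => x y [_ Bx] [_ By]; exact: bM.
Qed.

Lemma coarse_comp (X Y Z : metricType R) (g : Y -> Z) (f : X -> Y) :
  coarse g -> coarse f -> coarse (g \o f).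
Proof.
move=> [gc gp] [fc fp]; split=> [r r0|B bB].
  have [s s0 fs] := fc r r0; have [t t0 gt] := gc s s0.
  by exists t => // x x' _ _ xx'; apply: gt => //; exact: fs.
have [M bM] := fp _ (gp _ bB).
by exists M => x y [_ Bx] [_ By]; exact: bM.
Qed.

End MetricNotions.

Record pgeo (R : realType) := PGeoSpace {
  pgeo_sort :> metricType R;
  pgeo_proper : proper_space pgeo_sort;
  pgeo_geodesic : geodesic_space pgeo_sort
}.

Record coarse_map (R : realType) (X Y : metricType R) := CoarseMap {
  coarse_fun :> X -> Y;
  coarse_funP : coarse coarse_fun
}.

Section PGeoCategory.
Context {R : realType}.

Definition coarse_map_id (X : metricType R) : coarse_map X X :=
  CoarseMap (coarse_id X).

Definition coarse_map_comp (X Y Z : metricType R)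
    (g : coarse_map Y Z) (f : coarse_map X Y) : coarse_map X Z :=
  CoarseMap (coarse_comp (coarse_funP g) (coarse_funP f)).

Lemma coarse_map_ext (X Y : metricType R) (f g : coarse_map X Y) :
  coarse_fun f = coarse_fun g -> f = g.
Proof.
by case: f g => [f fP] [g gP] /= fg; subst g; rewrite (Prop_irrelevance fP gP).
Qed.

Lemma coarse_comp1m (X Y : metricType R) (f : coarse_map X Y) :
  coarse_map_comp (coarse_map_id Y) f = f.
Proof. exact: coarse_map_ext. Qed.

Lemma coarse_compm1 (X Y : metricType R) (f : coarse_map X Y) :
  coarse_map_comp f (coarse_map_id X) = f.
Proof. exact: coarse_map_ext. Qed.

Lemma coarse_compmA (X Y Z W : metricType R)
    (h : coarse_map Z W) (g : coarse_map Y Z) (f : coarse_map X Y) :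
  coarse_map_comp h (coarse_map_comp g f) =
  coarse_map_comp (coarse_map_comp h g) f.
Proof. exact: coarse_map_ext. Qed.

End PGeoCategory.

Definition PGeoCrs (R : realType) : category :=
  @Category (pgeo R) (fun X Y => coarse_map X Y)
    (fun X => coarse_map_id X)
    (fun X Y Z g f => coarse_map_comp g f)
    (fun X Y f => coarse_comp1m f)
    (fun X Y f => coarse_compm1 f)
    (fun X Y Z W h g f => coarse_compmA h g f).

Section Ends.
Context {R : realType}.

Definition path_component (X : topologicalType) (A : set X) (x : X) : set X :=
  [set y | exists g : R -> X, [/\ {within `[0, 1], continuous g},
     g 0 = x, g 1 = y & g @` `[0, 1] `<=` A]].

(* A ray is a function on R of which only the values on [0, +oo[ matter;
   [ray_equiv] below identifies rays that agree there. *)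
Definition continuous_ray (X : metricType R) (r : R -> X) : Prop :=
  {within `[0, +oo[, continuous r}.

(* The metric on the real line is carried by the alias [R^o]. *)
Definition metrically_proper_ray (X : metricType R) (r : R -> X) : Prop :=
  @metrically_proper_on R R^o X `[0, +oo[ r.

Definition controlled_ray (X : metricType R) (r : R -> X) : Prop :=
  @controlled_on R R^o X `[0, +oo[ r.

Definition end_ray (X : metricType R) (r : R -> X) : Prop :=
  metrically_proper_ray r /\ continuous_ray r.

Definition ray_equiv (X : metricType R) (r r' : R -> X) : Prop :=
  forall B : set X, mbounded B -> exists2 t : R, 0 <= t &
    exists2 x : X, (~` B) x &
      r @` `[t, +oo[ `<=` path_component (~` B) x /\
      r' @` `[t, +oo[ `<=` path_component (~` B) x.

Definition ray_class (X : metricType R) (r : R -> X) : set (R -> X) :=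
  [set r' | end_ray r' /\ ray_equiv r r'].

Definition ends (X : metricType R) : Type :=
  {e : set (R -> X) | exists2 r, end_ray r & e = ray_class r}.

Definition end_of (X : metricType R) (r : R -> X) (hr : end_ray r) : ends X :=
  exist _ (ray_class r) (ex_intro2 _ _ r hr erefl).

Definition geodesic_choice (X : metricType R) (u : X -> X -> R -> X) : Prop :=
  forall x y, geodesic_from_to x y (u x y).

Definition star (X : metricType R) (u : X -> X -> R -> X) (r : R -> X) :
    R -> X := fun h =>
  let x := r (Num.floor h)%:~R in
  let y := r (Num.ceil h)%:~R in
  u x y (mdist x y * (h - (Num.floor h)%:~R)).

(* [phi] is given by end(r) |-> end((f o r)^* ), for every representative [r]
   and every choice of geodesics for which end((f o r)^* ) makes sense.  For a
   metrically proper continuous ray [r], (f o r)^* can fail to be metrically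
   proper: take f the identity of the Euclidean plane and [r] running along
   half circles with r(n) = ((-1)^n (n + 1), 0), so that (f o r)^* passes
   through the origin infinitely often. *)
Definition induced_on_ends (X Y : metricType R) (f : X -> Y)
    (phi : ends X -> ends Y) : Prop :=
  forall (u : Y -> Y -> R -> Y) (r : R -> X) (hr : end_ray r),
    geodesic_choice u -> metrically_proper_ray (star u (f \o r)) ->
    exists hs : end_ray (star u (f \o r)), phi (end_of hr) = end_of hs.

End Ends.

(* Main.v *)
(* A coarse map f : X -> Y into a geodesic space carries paths to paths up to
   bounded error: cut a path of X into pieces of diameter less than 1, apply f to
   the cutting points, and join consecutive images by geodesics, whose length
   is bounded by some S.  If the path avoids the preimage of the
   S-neighbourhood of a bounded B, the new path avoids B.  Hence the end of any
   end ray s with s(n) = f(r(n)) for all n depends only on the end of r, and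
   on f up to closeness; all the functoriality claims follow, since
   (f o r)^* agrees with f o r on the integers.  What remains is that each end
   has a controlled representative: sample a representative r at times
   t_0 < t_1 < ... tending to infinity with d(r(t_n), r(t_(n+1))) <= 1, and
   join the samples by geodesics. *)
Require Import Defs.
From mathcomp Require Import all_boot all_order all_algebra.
From mathcomp Require Import all_classical all_reals all_analysis.
From mathcomp Require Import ring lra.

Set Implicit Arguments.
Unset Strict Implicit.
Unset Printing Implicit Defensive.

Import Order.TTheory GRing.Theory Num.Theory.
Import numFieldNormedType.Exports.
Local Open Scope classical_set_scope.
Local Open Scope ring_scope.

(** * Uniform continuity and concatenation of paths *)

Section Paths.
Context {R : realType}.
Local Notation path_component := (@path_component R _).

Lemma mdist_regular (x y : R^o) : mdist x y = `|x - y|.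
Proof. by rewrite distrC. Qed.

Lemma within_continuous_mdistP (X : metricType R) (A : set R) (g : R -> X) :
  {within A, continuous g} <->
  forall x, A x -> forall e : R, 0 < e -> exists2 d : R, 0 < d &
    forall y, A y -> `|x - y| < d -> mdist (g x) (g y) < e.
Proof.
split=> [/subspace_continuousP cg x Ax e e0|cg].
  have /metricType_numDomainType.cvgrPdist_lt/(_ e e0) := cg x Ax.
  rewrite near_withinE => /nbhs_ballP[d /= d0 dP].
  by exists d => // y Ay xy; apply: dP.
apply/subspace_continuousP => x Ax.
apply/metricType_numDomainType.cvgrPdist_lt => e e0.
rewrite near_withinE; apply/nbhs_ballP.
by have [d d0 dP] := cg x Ax e e0; exists d => //= y xy Ay; apply: dP.
Qed.

(** Compactness is used as a near-covering property: the candidate moduli run through the filter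
    [0^'+]. Halving both [d] and [e] at a point [x] handles all [y] near [x] and all small moduli at
    once, and the covering property then gives one modulus for the whole segment. *)
Lemma Heine_Cantor_segment (X : metricType R) (a b : R) (g : R -> X) (e : R) :
  {within `[a, b], continuous g} -> 0 < e ->
  exists2 d : R, 0 < d & forall s t, s \in `[a, b] -> t \in `[a, b] ->
    `|s - t| < d -> mdist (g s) (g t) < e.
Proof.
move=> /within_continuous_mdistP cg e0.
have /compact_near_coveringP/(_ R 0^'+ (fun d t => forall s,
  s \in `[a, b] -> t \in `[a, b] -> `|s - t| < d -> mdist (g s) (g t) < e)) := @segment_compact _ a b.
case=> [x abx|d /= d0 dP].
  have [d d0 dP] := cg x abx (e / 2) ltac:(lra).
  exists (ball x (d / 2), [set k | k < d / 2]) => /=.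
    split; first by apply: nbhsx_ballx; lra.
    by apply: nbhs_right_lt; lra.
  move=> [y k] /= [xy kd] s abs aby sy.
  have xs : mdist (g x) (g s) < e / 2.
    apply: dP => //; rewrite (le_lt_trans (ler_distD y _ _))//.
    by move: xy sy; rewrite /ball/= [`|s - y|]distrC; lra.
  have xy' : mdist (g x) (g y) < e / 2.
    by apply: dP => //; move: xy; rewrite /ball/=; lra.
  apply: le_lt_trans (metric_triangle _ (g x) _) _.
  by rewrite [mdist (g s) _]metric_sym; lra.
exists (d / 2) => [|s t abs abt st]; first lra.
by apply: (dP (d / 2)) => //=; rewrite ?sub0r ?normrN ?gtr0_norm; lra.
Qed.

Section PathComponents.
Context {X : metricType R}.
Implicit Types (A : set X) (x y z : X) (g : R -> X).

Lemma path_component_itv A g a b : a <= b ->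
  {within `[a, b], continuous g} -> (forall t, a <= t <= b -> A (g t)) ->
  path_component A (g a) (g b).
Proof.
move=> ab /within_continuous_mdistP cg gA.
have mem t : 0 <= t <= 1 -> a <= a + t * (b - a) <= b by nra.
exists (fun t => g (a + t * (b - a))); split.
- apply/within_continuous_mdistP => s /=; rewrite in_itv/= => s01 e e0.
  have [|d d0 dP] := cg (a + s * (b - a)) _ e e0.
    by rewrite /= in_itv/=; exact: mem.
  (* The added 1 keeps the denominator positive when [a = b]. *)
  exists (d / (b - a + 1)) => [|t]; first by rewrite divr_gt0//; lra.
  rewrite /= in_itv/= => t01; rewrite ltr_pdivlMr; last lra.
  move=> st; apply: dP; first by rewrite /= in_itv/=; exact: mem.
  rewrite (_ : _ - _ = (s - t) * (b - a)); last by ring.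
  rewrite normrM [`|b - a|]ger0_norm ?subr_ge0//.
  by rewrite (le_lt_trans _ st)// ler_wpM2l//; lra.
- by rewrite mul0r addr0.
- by congr g; ring.
- by move=> _ [t t01 <-]; apply: gA; apply: mem; move: t01; rewrite /= in_itv.
Qed.

Lemma path_component_sym A x y : path_component A x y -> path_component A y x.
Proof.
move=> [g [/within_continuous_mdistP cg <- <- gA]].
exists (fun t => g (1 - t)); split; rewrite ?subr0 ?subrr//.
- apply/within_continuous_mdistP => s /=; rewrite in_itv/= => s01 e e0.
  have [|d d0 dP] := cg (1 - s) _ e e0; first by rewrite /= in_itv/=; lra.
  exists d => // t; rewrite /= in_itv/= => t01 st.
  apply: dP; first by rewrite /= in_itv/=; lra.
  by rewrite (_ : _ - _ = t - s) 1?distrC//; ring.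
- move=> _ [t t01 <-]; apply: gA; exists (1 - t) => //.
  by move: t01; rewrite /= !in_itv/=; lra.
Qed.

(** The two paths are glued at time 1 into a path on [0, 2], which [path_component_itv] rescales to
    [0, 1]. *)
Lemma path_component_trans A x y z :
  path_component A x y -> path_component A y z -> path_component A x z.
Proof.
move=> [g [cg <- <- gA]] [h [ch h0 <- hA]].
pose k t := if t <= 1 then g t else h (t - 1).
have kh t : 1 <= t -> k t = h (t - 1).
  move=> t1; rewrite /k; case: ifPn => // t1'.
  by rewrite (_ : t = 1) ?subrr ?h0//; lra.
have kg t : t <= 1 -> k t = g t by rewrite /k => ->.
rewrite -(kg 0)// (_ : h 1 = k 2); last by rewrite kh; [congr h; ring|lra].
apply: path_component_itv => // [|t t02].
  have -> : [set` `[0, 2]] = [set` `[0, 1]] `|` [set` `[1, 2]] :> set R.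
    by apply/seteqP; split=> t /=; rewrite !in_itv/=; [case: (leP t 1); lra|lra].
  apply: withinU_continuous; [exact: interval_closed..| |];
    apply/within_continuous_mdistP => s /=; rewrite in_itv/= => s01 e e0.
  - have := (within_continuous_mdistP _ _).1 cg s; rewrite /= in_itv/=.
    move=> /(_ s01 e e0)[d d0 dP]; exists d => // t.
    rewrite in_itv/= => t01 st.
    by rewrite !kg ?dP//= ?in_itv/=; lra.
  - have := (within_continuous_mdistP _ _).1 ch (s - 1); rewrite /= in_itv/=.
    move=> /(_ ltac:(lra) e e0)[d d0 dP]; exists d => // t.
    rewrite in_itv/= => t01 st.
    rewrite !kh ?dP//= ?in_itv/=; try lra.
    by rewrite (_ : _ - _ = s - t)//; ring.
case: (leP t 1) => t1; [rewrite kg//; apply: gA; exists t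
                       |rewrite kh; [apply: hA; exists (t - 1)|]] => //=;
  rewrite ?in_itv/=; lra.
Qed.

End PathComponents.
End Paths.

(** * Images of paths under coarse maps *)

Section Coarse.
Context {R : realType}.
Local Notation path_component := (@path_component R _).
Implicit Types X Y : metricType R.

Definition thickening X (C : R) (B : set X) : set X :=
  [set x | exists2 y, B y & mdist x y <= C].

Lemma mbounded_thickening X (C : R) (B : set X) :
  mbounded B -> mbounded (thickening C B).
Proof.
move=> [M BM]; exists (M + C *+ 2) => x x' [y By xy] [y' By' xy'].
have := metric_triangle x y x'; have := metric_triangle y y' x'.
by have := BM _ _ By By'; rewrite [mdist y' _]metric_sym; lra.
Qed.

(** Every point of a geodesic from [x] to [y] is within [C] of [x], so a point of it in [B] would
    put [x] in the thickening. *)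
Lemma path_component_thickening X (C : R) (B : set X) x y :
  geodesic_space X -> ~ thickening C B x -> mdist x y <= C ->
  path_component (~` B) x y.
Proof.
move=> /(_ x y)[u [uE u0 ud]] xB xyC.
rewrite -u0 -ud; apply: path_component_itv; first exact: mdist_ge0.
  apply/within_continuous_mdistP => s sd e e0; exists e => // t td st.
  by rewrite uE.
move=> t t0d But; apply: xB; exists (u t) => //; rewrite -{1}u0 uE.
- by rewrite sub0r normrN ger0_norm; lra.
- by rewrite in_itv/= lexx mdist_ge0.
- by rewrite in_itv.
Qed.

Lemma coarse_path_component X Y (f : X -> Y) (S : R) (B : set Y) x x' :
  geodesic_space Y ->
  (forall x x', mdist x x' < 1 -> mdist (f x) (f x') <= S) ->
  path_component (~` (f @^-1` thickening S B)) x x' ->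
  path_component (~` B) (f x) (f x').
Proof.
move=> geoY fS [g [cg <- <- gA]].
have [d d0 dP] := Heine_Cantor_segment cg ltr01.
(* The mesh 1/n is smaller than [d], so consecutive cutting points [g (i / n)] are at distance less
   than 1. *)
pose n := (Num.truncn d^-1).+1.
have n0 : 0 < n%:R :> R by rewrite ltr0n.
have nd : n%:R^-1 < d.
  by rewrite invf_plt ?posrE// /n truncnS_gt.
have farg (t : R) : 0 <= t <= 1 -> ~ thickening S B (f (g t)).
  by move=> t01; apply: gA; exists t => //=; rewrite in_itv.
have S0 : 0 <= S by have := fS x x; rewrite !mdistxx; apply.
suff pathi i : (i <= n)%N -> path_component (~` B) (f (g 0)) (f (g (i%:R / n%:R))).
  by have := pathi n (leqnn n); rewrite divff// gt_eqF.
elim: i => [_|i IH lein].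
  by rewrite mul0r; apply: path_component_thickening geoY (farg 0 _) _ => //;
    rewrite ?mdistxx//; lra.
have in01 j : (j <= n)%N -> 0 <= (j%:R / n%:R : R) <= 1.
  by move=> jn; rewrite divr_ge0//= ler_pdivrMr// mul1r ler_nat.
apply: path_component_trans (IH (ltnW lein)) _.
have fari := farg _ (in01 _ (ltnW lein)).
apply: (path_component_thickening geoY fari).
apply/fS/dP; rewrite ?in_itv/= ?in01// 1?ltnW//.
rewrite -mulrBl -natr1 opprD addNKr mulN1r normrN gtr0_norm// invr_gt0//.
Qed.

(** * Piecewise geodesic interpolation *)

Section Star.
Context {X : metricType R} (u : X -> X -> R -> X) (r : R -> X).
Hypothesis u_geo : geodesic_choice u.
Local Notation step n := (mdist (r n%:R) (r n.+1%:R)).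

Lemma star_nat n : star u r n%:R = r n%:R.
Proof.
rewrite /star -[n%:R]/(n%:Z%:~R) intrKfloor intrKceil mdistxx mul0r.
by have [_ ->] := u_geo (r n%:Z%:~R) (r n%:Z%:~R).
Qed.

(** At an integer, floor and ceiling coincide and [star] follows a geodesic of length 0, so both
    endpoints are checked separately. With closed intervals, adjacent pieces share their common
    endpoint. *)
Lemma star_itv n t : n%:R <= t <= n.+1%:R ->
  star u r t = u (r n%:R) (r n.+1%:R) (step n * (t - n%:R)).
Proof.
have [_ u0 u1] := u_geo (r n%:R) (r n.+1%:R).
have [->|tn nt] := eqVneq t n%:R; first by rewrite star_nat subrr mulr0.
have [->|tn1] := eqVneq t n.+1%:R.
  rewrite star_nat (_ : _ - _ = 1) ?mulr1 ?u1// -natr1; ring.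
have tn' : n%:R < t < n.+1%:R.
  by rewrite !lt_neqAle eq_sym tn tn1.
have nS : n.+1%:R = n.+1%:Z%:~R :> R by [].
rewrite /star (@floor_def _ _ n%:Z) ?(@ceil_def _ _ n.+1%:Z)//.
- by rewrite -addn1 PoszD addrK -pmulrn; move: tn'; rewrite -addn1; lra.
- by rewrite -PoszD addn1 -!pmulrn; lra.
Qed.

Lemma mdist_star_itv n s t :
  n%:R <= s <= n.+1%:R -> n%:R <= t <= n.+1%:R ->
  mdist (star u r s) (star u r t) = step n * `|s - t|.
Proof.
move=> sn tn; rewrite !(star_itv (n := n))//.
have [uE _ _] := u_geo (r n%:R) (r n.+1%:R).
have d0 := mdist_ge0 (r n%:R) (r n.+1%:R).
have nS : n.+1%:R = n%:R + 1 :> R by rewrite natr1.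
rewrite uE ?in_itv/=; [|nra..].
by rewrite -mulrBr normrM ger0_norm//; congr (_ * `|_|); ring.
Qed.

(** Induction on [N], splitting at time [N] when [s] and [t] lie on different sides of it. Bounding
    only the first [N] steps lets the estimate serve both for local continuity and, with a uniform
    [L], for control. *)
Lemma star_lipschitz (L : R) (N : nat) s t :
  (forall n, (n < N)%N -> step n <= L) ->
  0 <= s <= N%:R -> 0 <= t <= N%:R ->
  mdist (star u r s) (star u r t) <= L * `|s - t|.
Proof.
wlog st : s t / s <= t.
  move=> wl hL hs ht; have [/wl|/ltW /wl] := leP s t; first exact.
  by rewrite metric_sym distrC; exact.
elim: N s t st => [|N IH] s t st hL hs ht.
  have [-> ->] : s = 0 /\ t = 0 by lra.
  by rewrite mdistxx subrr normr0 mulr0.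
have hL' n : (n < N)%N -> step n <= L by move=> ?; apply/hL/ltnW.
have dN := hL N (ltnSn N).
have NS : N.+1%:R = N%:R + 1 :> R by rewrite natr1.
have lastN a b : N%:R <= a <= N.+1%:R -> N%:R <= b <= N.+1%:R ->
    mdist (star u r a) (star u r b) <= L * `|a - b|.
  by move=> ha hb; rewrite (mdist_star_itv ha hb) ler_wpM2r.
have [tN|Nt] := leP t N%:R; first by apply: IH => //; lra.
have [Ns|sN] := leP N%:R s; first by apply: lastN; lra.
apply: le_trans (metric_triangle _ (star u r N%:R) _) _.
have sNl := IH s N%:R (ltW sN) hL' ltac:(lra) ltac:(lra).
have Ntl := lastN N%:R t ltac:(lra) ltac:(lra).
by move: sNl Ntl; rewrite !ler0_norm; lra.
Qed.

End Star.
End Coarse.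

(** * Equivalence of rays *)

Section Rays.
Context {R : realType}.
Local Notation path_component := (@path_component R _).
Implicit Types X Y : metricType R.

Lemma proper_ray_leaves X (r : R -> X) (B : set X) :
  metrically_proper_ray r -> mbounded B ->
  exists2 T : R, 0 <= T & forall t, T <= t -> ~ B (r t).
Proof.
move=> /[apply] -[M rM].
have [[a [a0 Ba]]|Ab] := pselect (([set` `[0, +oo[] `&` r @^-1` B) !=set0); last first.
  by exists 0 => // t t0 Bt; apply: Ab; exists t; rewrite /= in_itv/= t0.
move: (a0); rewrite /= in_itv/= andbT => a0'.
(* A time [t] this late is more than [M] away from [a], while both would lie in the preimage of
   [B]. *)
exists (a + `|M| + 1) => [|t tM Bt]; first by rewrite !addr_ge0.
have M0 := normr_ge0 M; have /= := rM t a.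
rewrite mdist_regular => /(_ (conj _ Bt) (conj a0 Ba)).
rewrite in_itv/= andbT => /(_ ltac:(lra)); rewrite ger0_norm; last lra.
by have := ler_norm M; lra.
Qed.

Lemma end_ray_path_component X (r : R -> X) (B : set X) (a b : R) :
  continuous_ray r -> 0 <= a -> 0 <= b ->
  (forall t, Num.min a b <= t -> ~ B (r t)) -> path_component (~` B) (r a) (r b).
Proof.
wlog ab : a b / a <= b.
  move=> wl cr a0 b0 rB; have [/wl|/ltW /wl ba] := leP a b; first exact.
  by apply: path_component_sym; apply: ba => //; rewrite minC.
move=> cr a0 b0 rB; apply: path_component_itv => // [|t /andP[at_ _]].
  by apply: continuous_subspaceW cr => t /=; rewrite !in_itv/= andbT; lra.
by apply: rB; rewrite min_l.
Qed.

(** Once a ray has left [B] for good, its tail is itself a path outside [B]. Hence one connection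
    between late points joins the two tails, and the two times may differ. *)
Lemma ray_equiv_frequently X (r r' : R -> X) : end_ray r -> end_ray r' ->
  (forall (B : set X) (T : R), mbounded B -> exists a b : R,
    [/\ T <= a, T <= b & path_component (~` B) (r a) (r' b)]) ->
  ray_equiv r r'.
Proof.
move=> [rp rc] [rp' rc'] meet B bB.
have [T T0 rT] := proper_ray_leaves rp bB.
have [T' T'0 rT'] := proper_ray_leaves rp' bB.
have [a [b [aT bT ab]]] := meet B (Num.max T T') bB.
move: aT bT; rewrite !ge_max => /andP[aT aT'] /andP[bT bT'].
exists (Num.max T T'); first by rewrite le_max T0.
exists (r a); first exact: rT.
split=> _ [t /= + <-]; rewrite in_itv/= andbT ge_max => /andP[tT tT'].
  apply: end_ray_path_component => // [||s]; [lra..|].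
  by move=> ms; apply: rT; rewrite (le_trans _ ms)// le_min aT.
apply: path_component_trans ab _.
apply: end_ray_path_component => // [||s]; [lra..|].
by move=> ms; apply: rT'; rewrite (le_trans _ ms)// le_min bT'.
Qed.

Lemma ray_equiv_eventually X (r r' : R -> X) (B : set X) :
  ray_equiv r r' -> mbounded B -> exists2 T : R, 0 <= T &
    forall a b, T <= a -> T <= b -> path_component (~` B) (r a) (r' b).
Proof.
move=> /[apply] -[T T0 [x _ [rT rT']]]; exists T => // a b Ta Tb.
apply: (path_component_trans (path_component_sym (rT (r a) _)) (rT' (r' b) _)).
  by exists a => //=; rewrite in_itv/= Ta.
by exists b => //=; rewrite in_itv/= Tb.
Qed.

Lemma ray_equiv_refl X (r : R -> X) : end_ray r -> ray_equiv r r.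
Proof.
move=> rE; have [rp rc] := rE; apply: ray_equiv_frequently => // B T bB.
have [T' T'0 rT] := proper_ray_leaves rp bB.
exists (Num.max T T'), (Num.max T T'); rewrite !le_max lexx; split=> //.
by apply: end_ray_path_component => // [||s]; rewrite ?minxx ?le_max ?T'0 ?orbT//
  ge_max => /andP[_ /rT].
Qed.

Lemma ray_equiv_sym X (r r' : R -> X) : ray_equiv r r' -> ray_equiv r' r.
Proof.
by move=> rr B /rr[t t0 [x xB [rx rx']]]; exists t => //; exists x.
Qed.

Lemma ray_equiv_trans X (r1 r2 r3 : R -> X) : end_ray r1 -> end_ray r3 ->
  ray_equiv r1 r2 -> ray_equiv r2 r3 -> ray_equiv r1 r3.
Proof.
move=> r1E r3E r12 r23; apply: ray_equiv_frequently => // B T bB.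
have [T1 _ T1P] := ray_equiv_eventually r12 bB.
have [T2 _ T2P] := ray_equiv_eventually r23 bB.
pose t := Num.max T (Num.max T1 T2).
have [tT tT1 tT2] : [/\ T <= t, T1 <= t & T2 <= t].
  by rewrite /t !le_max !lexx !orbT.
by exists t, t; split=> //; apply: path_component_trans (T1P t t _ _) (T2P t t _ _).
Qed.

Lemma end_of_eqP X (r r' : R -> X) (hr : end_ray r) (hr' : end_ray r') :
  end_of hr = end_of hr' <-> ray_equiv r r'.
Proof.
split=> [/(congr1 sval) /= rr'|rr'].
  have : ray_class r' r' by split=> //; exact: ray_equiv_refl.
  by rewrite -rr' => -[].
apply: eq_exist; apply/seteqP; split=> s [sE rs]; split=> //.
  by apply: ray_equiv_trans rs => //; exact: ray_equiv_sym.
by apply: ray_equiv_trans rs.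
Qed.

(** At a late integer [n], the path from [r n] to [r' n] is pushed forward to one from [f (r n)] to
    [f (r' n)], and a geodesic of length at most [C] continues to [f' (r' n)]. Well-definedness,
    invariance under closeness and functoriality are all instances. *)
Lemma close_coarse_ray_equiv X Y (f f' : X -> Y) (r r' : R -> X) (s s' : R -> Y) :
  geodesic_space Y -> coarse f -> close_maps f f' -> ray_equiv r r' ->
  end_ray r' -> end_ray s -> end_ray s' ->
  (forall n : nat, s n%:R = f (r n%:R)) ->
  (forall n : nat, s' n%:R = f' (r' n%:R)) -> ray_equiv s s'.
Proof.
move=> geoY [fc fp] [C C0 ff'] rr' [rp' _] sE sE' sf sf'.
apply: ray_equiv_frequently => // B T bB.
have [S S0 fS] := fc 1 ltr01.
have bB1 : mbounded (f @^-1` thickening S B).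
  by have := fp _ (mbounded_thickening S bB); rewrite setTI.
have bB2 : mbounded (f @^-1` thickening C B).
  by have := fp _ (mbounded_thickening C bB); rewrite setTI.
have [T1 T10 T1P] := ray_equiv_eventually rr' bB1.
have [T2 T20 T2P] := proper_ray_leaves rp' bB2.
pose n := (Num.truncn (Num.max T (Num.max T1 T2))).+1.
have : Num.max T (Num.max T1 T2) <= n%:R by apply/ltW/truncnS_gt.
rewrite !ge_max => /and3P[nT nT1 nT2].
exists n%:R, n%:R; split=> //; rewrite sf sf'.
apply: path_component_trans (_ : path_component _ _ (f (r' n%:R))) _.
  apply: coarse_path_component geoY _ (T1P _ _ nT1 nT1).
  by move=> x x' xx'; exact/ltW/fS.
by apply: path_component_thickening geoY (T2P _ nT2) (ff' _).
Qed.

(** * Interpolated rays: continuity, control and properness *)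

Section StarRays.
Context {X : metricType R} (u : X -> X -> R -> X) (r : R -> X).
Hypothesis u_geo : geodesic_choice u.

(** Near a given time only finitely many steps of [r] matter, so [star u r] is locally Lipschitz for
    arbitrary [r]. *)
Lemma star_continuous : continuous_ray (star u r).
Proof.
apply/within_continuous_mdistP => s; rewrite /= in_itv/= andbT => s0 e e0.
(* The second successor leaves room for all times within 1 of [s]. *)
pose N := (Num.truncn s).+2.
have sN : s + 1 <= N%:R.
  by rewrite -[N%:R]natr1 lerD2r; apply/ltW/truncnS_gt.
have [L L0 hL] : exists2 L : R, 0 < L &
    forall n, (n < N)%N -> mdist (r n%:R) (r n.+1%:R) <= L.
  exists (1 + \sum_(i < N) mdist (r i%:R) (r i.+1%:R)) => [|n nN].
    by rewrite ltr_pwDl// sumr_ge0// => i _; exact: mdist_ge0.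
  rewrite (bigD1 (Ordinal nN))//= addrCA lerDl addr_ge0// sumr_ge0// => i _.
  exact: mdist_ge0.
exists (Num.min 1 (e / L)) => [|t]; first by rewrite lt_min ltr01 divr_gt0.
rewrite /= in_itv/= andbT lt_min => t0 /andP[st1 stL].
apply: le_lt_trans (star_lipschitz u_geo hL _ _) _.
- by lra.
- by move: st1; rewrite distrC ltr_distl; lra.
- by rewrite mulrC -ltr_pdivlMr.
Qed.

Lemma star_controlled (L : R) :
  (forall n : nat, mdist (r n%:R) (r n.+1%:R) <= L) ->
  controlled_ray (star u r).
Proof.
(* The added 1 makes the bound positive and strict even if [L = 0]. *)
move=> hL d d0; exists (L * d + 1) => [|s t].
  by rewrite ltr_wpDl// mulr_ge0 ?(ltW d0)//; apply: le_trans (hL 0%N); exact: mdist_ge0.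
rewrite /= !in_itv/= !andbT mdist_regular => s0 t0 st.
pose N := (Num.truncn (Num.max s t)).+1.
have : Num.max s t <= N%:R by apply/ltW/truncnS_gt.
rewrite ge_max => /andP[sN tN].
apply: le_lt_trans (star_lipschitz u_geo (N := N) (L := L) _ _ _) _;
  rewrite ?s0 ?t0//.
have L0 : 0 <= L by apply: le_trans (hL 0%N); exact: mdist_ge0.
by rewrite ltr_pwDr// ler_wpM2l// ltW.
Qed.

(** The interpolated point at time [t] is within [L] of the sample at the floor of [t]. So if it
    lies in [B], that sample lies in the [L]-thickening of [B], which the samples eventually
    avoid. *)
Lemma star_end_ray (L : R) :
  (forall n : nat, mdist (r n%:R) (r n.+1%:R) <= L) ->
  (forall B : set X, mbounded B ->
    exists N : nat, forall n : nat, (N <= n)%N -> ~ B (r n%:R)) ->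
  end_ray (star u r).
Proof.
move=> hL leave; split; last exact: star_continuous.
move=> B /(mbounded_thickening L)/leave[N NP].
suff hN t : 0 <= t -> B (star u r t) -> t <= N%:R.
  exists N%:R => s t [+ Bs] [+ Bt]; rewrite /= !in_itv/= !andbT => s0 t0.
  have := hN s s0 Bs; have := hN t t0 Bt.
  by rewrite mdist_regular ler_distl; lra.
move=> t0 Bt; rewrite leNgt; apply/negP => Nt.
have tn := truncn_itv t0; set n := Num.truncn t in tn.
apply: (NP n); first by rewrite /n truncn_ge_nat// ltW.
exists (star u r t) => //; rewrite -(star_nat r u_geo).
have nS : n.+1%:R = n%:R + 1 :> R by rewrite natr1.
rewrite (mdist_star_itv r u_geo (n := n)); [|lra..].
apply: le_trans (hL n); rewrite ler_piMr ?mdist_ge0//.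
by rewrite ler_distl; lra.
Qed.

End StarRays.

Lemma coarse_star_end_ray X Y (f : X -> Y) (u : Y -> Y -> R -> Y) (r : R -> X) :
  geodesic_choice u -> coarse f -> end_ray r -> controlled_ray r ->
  end_ray (star u (f \o r)).
Proof.
move=> ugeo [fc fp] [rp _] rc.
(* Consecutive integers are at distance 1, and [controlled_on] asks for a strict bound, hence 2. *)
have [s s0 rs] := rc 2 (ltr0Sn _ 1).
have [S S0 fS] := fc s s0.
apply: (star_end_ray ugeo (L := S)) => [n|B bB].
  apply/ltW/fS => //; apply: rs; rewrite ?/= ?in_itv/= ?ler0n//.
  by rewrite mdist_regular ler0_norm -?natr1; lra.
have [|T T0 TP] := proper_ray_leaves rp (B := f @^-1` B).
  by have := fp _ bB; rewrite setTI.
exists (Num.truncn T).+1 => n nT; apply: TP.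
by apply/ltW/(lt_le_trans (truncnS_gt T)); rewrite ler_nat.
Qed.

End Rays.

(** * Controlled representatives of ends *)

Section ControlledRepresentative.
Context {R : realType} {X : metricType R} (r : R -> X).
Hypothesis r_cont : continuous_ray r.

(** A fixed time step need not work, since [r] is uniformly continuous only on bounded intervals.
    The step at time [x] is therefore adapted to the integer part of [x]. *)
Lemma unbounded_short_steps : exists t : nat -> R,
  [/\ {homo t : m n / (m <= n)%N >-> m <= n},
      forall T, exists n, T < t n,
      forall n, 0 <= t n &
      forall n, mdist (r (t n)) (r (t n.+1)) <= 1].
Proof.
(* A time with integer part [n] is below [n + 1] and a step has length at most 1, so both ends of
   the step lie in [0, n + 2]. *)
pose fine (n k : nat) := forall s t : R, 0 <= s <= n.+2%:R -> 0 <= t <= n.+2%:R ->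
  `|s - t| <= k.+1%:R^-1 -> mdist (r s) (r t) <= 1.
have fine_ex n : exists k, `[< fine n k >].
  have [|d d0 dP] := @Heine_Cantor_segment _ _ 0 n.+2%:R r 1 _ ltr01.
    by apply: continuous_subspaceW r_cont => t; rewrite /= !in_itv/= andbT => /andP[].
  exists (Num.truncn d^-1); apply/asboolP => s t sn tn st.
  apply/ltW/dP; rewrite ?in_itv//; apply: le_lt_trans st _.
  by rewrite invf_plt ?posrE// truncnS_gt.
(* The least admissible k is monotone in n, so the steps below stay bounded
   away from 0 as long as the times are bounded. *)
pose k n := ex_minn (fine_ex n).
have kP n : fine n (k n) by rewrite /k; case: ex_minnP => m /asboolP.
have k_mono m n : (m <= n)%N -> (k m <= k n)%N.
  move=> mn; rewrite {1}/k; case: ex_minnP => i _; apply.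
  have mn2 : m.+2%:R <= n.+2%:R :> R by rewrite ler_nat.
  by apply/asboolP => s t sm tm; apply: kP; lra.
pose t n : R := iter n (fun x => x + (k (Num.truncn x)).+1%:R^-1) 0.
have tS n : t n.+1 = t n + (k (Num.truncn (t n))).+1%:R^-1 by [].
have t_step n : t n <= t n.+1 by rewrite tS lerDl.
have t_ge0 n : 0 <= t n by elim: n => // n; move/le_trans; apply.
have t_mono : {homo t : m n / (m <= n)%N >-> m <= n}.
  by apply: homo_leq t_step => //; exact: le_trans.
(* Up to time [M] every step has length at least [1 / (k M + 1)]; this linear growth forces the
   times past any bound. *)
have t_low (M i : nat) : t i <= M%:R -> i%:R <= t i * (k M).+1%:R.
  elim: i => [_|i IH tM]; first by rewrite mul0r.
  have tiM := le_trans (t_step i) tM.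
  rewrite tS mulrDl -natr1 lerD ?IH//.
  rewrite mulrC ler_pdivlMr// mul1r ler_nat ltnS k_mono//.
  by rewrite -(ler_nat R) (le_trans _ tiM)// truncn_le.
exists t; split=> // [T|n].
  pose M := (Num.truncn T).+1.
  exists (M * (k M).+1).+1; apply: lt_trans (truncnS_gt T) _.
  rewrite ltNge; apply/negP => tM.
  have := le_trans (t_low _ _ tM) (ler_wpM2r (ler0n R _) tM).
  by rewrite -natrM ler_nat ltnn.
have := truncn_itv (t_ge0 n); set N := Num.truncn (t n) => tN.
have NS1 : N.+1%:R = N%:R + 1 :> R by rewrite natr1.
have NS2 : N.+2%:R = N%:R + 2 :> R by rewrite -addn2 natrD.
have kN1 : (k N).+1%:R^-1 <= 1 :> R by rewrite invf_le1// ler1n.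
have tn1 : t n.+1 <= t n + 1 by rewrite tS lerD2l.
have tn := t_ge0 n; have tnS := t_step n.
apply: (kP N); [lra|lra|].
by rewrite distrC tS addrC addKr ger0_norm.
Qed.

End ControlledRepresentative.

(** The interpolated ray meets [r] at each sample: its value at [n] is [r (t n)]. These common
    points occur arbitrarily late, which suffices by [ray_equiv_frequently]. *)
Lemma controlled_representative (R : realType) (X : metricType R) (r : R -> X) :
  geodesic_space X -> end_ray r ->
  exists2 r' : R -> X, controlled_ray r' /\ end_ray r' & ray_equiv r r'.
Proof.
move=> geoX rE; have [rp rc] := rE.
have [t [t_mono t_unb t_ge0 t_step]] := unbounded_short_steps rc.
have [u0 u0P] := choice (fun xy : X * X => geoX xy.1 xy.2).
pose u x y := u0 (x, y).
have ugeo : geodesic_choice u by move=> x y; exact: (u0P (x, y)).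
pose q (h : R) := r (t (Num.truncn h)).
have qE n : q n%:R = r (t n) by rewrite /q natrK.
have q_step n : mdist (q n%:R) (q n.+1%:R) <= 1 by rewrite !qE.
have q_leave B : mbounded B ->
    exists N : nat, forall n : nat, (N <= n)%N -> ~ B (q n%:R).
  move=> /(proper_ray_leaves rp)[T _ TP].
  have [N tN] := t_unb T; exists N => n Nn; rewrite qE; apply: TP.
  by rewrite (le_trans (ltW tN))// t_mono.
have sE := star_end_ray ugeo q_step q_leave.
exists (star u q); first by split=> //; exact: (star_controlled ugeo q_step).
apply: ray_equiv_frequently => // B T bB.
have [N tN] := t_unb T.
have [T' _ TP'] := proper_ray_leaves rp bB.
have [N' tN'] := t_unb T'.
pose n := maxn (Num.truncn T).+1 (maxn N N').
have [nT nN nN'] : [/\ ((Num.truncn T).+1 <= n)%N, (N <= n)%N & (N' <= n)%N].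
  by rewrite /n !leq_max !leqnn !orbT.
exists (t n), n%:R; split.
- by rewrite (le_trans (ltW tN))// t_mono.
- by apply: le_trans (ltW (truncnS_gt T)) _; rewrite ler_nat.
rewrite star_nat// qE.
apply: end_ray_path_component => // s; rewrite minxx => ns.
by apply: TP'; rewrite (le_trans (ltW tN'))// (le_trans _ ns)// t_mono.
Qed.


(** * The functor of ends *)

Theorem theorem3p10 (R : realType) :
  (* every end has a controlled representative r, and for those (f o r)^* is
     a metrically proper continuous ray *)
  (forall (X : pgeo R) (e : ends X),
     exists2 r : R -> X, controlled_ray r & exists hr : end_ray r, e = end_of hr) /\
  (forall (X Y : pgeo R) (f : coarse_map X Y) (u : Y -> Y -> R -> Y) (r : R -> X),
     geodesic_choice u -> end_ray r -> controlled_ray r ->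
     end_ray (star u (f \o r))) /\
  exists F : forall X Y : pgeo R, coarse_map X Y -> ends X -> ends Y,
    (forall (X Y : pgeo R) (f : coarse_map X Y),
       induced_on_ends f (F X Y f) /\
       (forall phi : ends X -> ends Y, induced_on_ends f phi -> phi = F X Y f)) /\
    @is_functor (PGeoCrs R) Sets (fun X : pgeo R => ends X) F /\
    (forall (X Y : pgeo R) (f f' : coarse_map X Y),
       close_maps f f' -> F X Y f = F X Y f').
Proof.
have rep (X : pgeo R) (e : ends X) :
    exists r, controlled_ray r /\ exists hr : end_ray r, e = end_of hr.
  case: e => E EP; have [r rE Er] := EP.
  have -> : exist _ E EP = end_of rE by exact: eq_exist.
  have [r' [r'c r'E] rr'] := controlled_representative (@pgeo_geodesic _ X) rE.
  by exists r'; split=> //; exists r'E; apply/(end_of_eqP rE r'E).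
have geo (X : pgeo R) : exists u : X -> X -> R -> X, geodesic_choice u.
  have [u uP] := choice (fun xy : X * X => @pgeo_geodesic _ X xy.1 xy.2).
  by exists (fun x y => u (x, y)) => x y; exact: (uP (x, y)).
have starE (X Y : pgeo R) (f : coarse_map X Y) (u : Y -> Y -> R -> Y) (r : R -> X) :
    geodesic_choice u -> end_ray r -> controlled_ray r ->
    end_ray (star u (f \o r)).
  by move=> ugeo; exact: coarse_star_end_ray ugeo (coarse_funP f).
have closeff (X Y : pgeo R) (f : coarse_map X Y) : close_maps f f.
  by exists 0 => // x; rewrite mdistxx.
(* The map is built from chosen controlled representatives, but its specification covers every
   representative [r], every end ray [s] with the right integer values and every [f'] close to [f].
   The rest of the proof uses only this specification. *)
have FE (X Y : pgeo R) (f : coarse_map X Y) : exists phi : ends X -> ends Y,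
    forall (f' : coarse_map X Y) (r : R -> X) (s : R -> Y)
      (hr : end_ray r) (hs : end_ray s),
    close_maps f f' -> (forall n : nat, s n%:R = f' (r n%:R)) ->
    phi (end_of hr) = end_of hs.
  have [u ugeo] := geo Y.
  have [c cP] := choice (rep X).
  have cE e : end_ray (c e) by have [_ []] := cP e.
  have eE e : e = end_of (cE e).
    by have [_ [hr {1}->]] := cP e; apply/end_of_eqP; exact: ray_equiv_refl.
  have sE e := starE X Y f u (c e) ugeo (cE e) (cP e).1.
  exists (fun e => end_of (sE e)) => f' r s hr hs ff' sf'.
  apply/end_of_eqP.
  apply: (close_coarse_ray_equiv (@pgeo_geodesic _ Y) (coarse_funP f) ff' _ hr) => //.
    by apply/(end_of_eqP (cE _) hr); rewrite -eE.
  by move=> n; rewrite star_nat.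
split; first by move=> X e; have [r []] := rep X e; exists r.
split=> //.
pose F (X Y : pgeo R) (f : coarse_map X Y) := projT1 (cid (FE X Y f)).
have FP (X Y : pgeo R) (f f' : coarse_map X Y) (r : R -> X) (s : R -> Y)
    (hr : end_ray r) (hs : end_ray s) : close_maps f f' ->
    (forall n : nat, s n%:R = f' (r n%:R)) -> F X Y f (end_of hr) = end_of hs.
  by rewrite /F; case: cid => phi /= phiP; exact: phiP.
exists F; split=> [X Y f|].
  split=> [u r hr ugeo sp|phi phiP].
    have hs : end_ray (star u (f \o r)) by split=> //; exact: star_continuous.
    by exists hs; apply: (FP X Y f f) => // n; rewrite star_nat.
  have [u ugeo] := geo Y.
  (* Uniqueness: on a controlled representative the interpolated ray is an end ray, so
     [induced_on_ends] forces the value of [phi]. *)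
  apply/funext => e; have [r [rc [hr ->]]] := rep X e.
  have [hs ->] := phiP u r hr ugeo (starE X Y f u r ugeo hr rc).1.
  by apply/esym/(FP X Y f f) => // n; rewrite star_nat.
split; last first.
  move=> X Y f f' ff'; have [u ugeo] := geo Y.
  apply/funext => e; have [r [rc [hr ->]]] := rep X e.
  have hs := starE X Y f' u r ugeo hr rc.
  (* The same ray, built from [f'], computes the values of both maps. *)
  by rewrite (FP X Y f f' r _ hr hs) ?(FP X Y f' f' r _ hr hs)// => n;
    rewrite star_nat.
split=> [X|X Y Z g f]; apply/funext => e; have [r [rc [hr ->]]] := rep X e.
  (* For the identity, [r] serves as its own image ray. *)
  exact: (FP X X (coarse_map_id X) (coarse_map_id X)).
have [[u ugeo] [v vgeo]] := (geo Y, geo Z).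
have hs := starE X Y f u r ugeo hr rc.
have hs' := starE X Z (coarse_map_comp g f) v r vgeo hr rc.
rewrite /= (FP X Z _ (coarse_map_comp g f) r _ hr hs')//; last first.
  by move=> n; rewrite star_nat.
rewrite (FP X Y f f r _ hr hs)//; last by move=> n; rewrite star_nat.
(* The ray [star u (f \o r)] now represents the end in [Y], and the ray built from [g \o f] has the
   values of [g] along it at the integers. *)
apply/esym; apply: (FP Y Z g g) => // n.
by rewrite !star_nat.
Qed.
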